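(* Let $G$ be an abelian group. Then the following assertions are equivalent: (a) no subgroup of $G$ of size $<\mathfrak{c}$ admits a non-discrete locally minimal and locally GTG group topology; (b) no countable subgroup of $G$ admits a non-discrete locally quasi-convex UFSS group topology; (c) $G$ is bounded.
   Context: $\mathfrak{c}=2^\omega$; $\mathbb{N}$ is the set of positive integers. An abelian group $G$ is bounded if there is $n\in\mathbb{N}$ with $nx=0$ for all $x\in G$. For a symmetric subset $U\ni0$ of an abelian group $G$ and $n\in\mathbb{N}$, $(1/n)U:=\{x\in G: kx\in U\ \forall k\in\{1,\dots,n\}\}$. Such a $U$ is a GTG subset of $G$ if $\{(1/n)U:n\in\mathbb{N}\}$ is a basis of neighborhoods of zero for a (not necessarily Hausdorff) group topology on $G$. A Hausdorff topological abelian group is locally GTG if it has a basis of neighborhoods of $0$ consisting of GTG subsets. A Hausdorff topological group $(G,\tau)$ is UFSS if for some symmetric neighborhood $U$ of $0$ the sets $(1/n)U$, $n\in\mathbb{N}$, form a neighborhood basis at $0$ for $\tau$. Let $\mathbb{T}=\mathbb{R}/\mathbb{Z}$, $q:\mathbb{R}\to\mathbb{T}$ the canonical projection and $\mathbb{T}_+=q([-1/4,1/4])$. For a topological abelian group $G$, $G^\wedge$ is the group of continuous homomorphisms $G\to\mathbb{T}$. A subset $A\subseteq G$ is quasi-convex if for every $x\in G\setminus A$ there is $\chi\in G^\wedge$ with $\chi(A)\subseteq\mathbb{T}_+$ and $\chi(x)\notin\mathbb{T}_+$. A topological abelian group is locally quasi-convex if it has a basis of neighborhoods of $0$ consisting of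 quasi-convex sets. A Hausdorff topological group $(G,\tau)$ is locally minimal if there exists a neighborhood $V$ of $0$ such that whenever $\sigma\subseteq\tau$ is a Hausdorff group topology on $G$ for which $V$ is a $\sigma$-neighborhood of $0$, then $\sigma=\tau$. *)

(* Defs.v *)
From HB Require Import structures.
From mathcomp Require Import all_boot all_order all_algebra.
From mathcomp Require Import all_classical all_reals all_analysis.

Set Implicit Arguments.
Unset Strict Implicit.
Unset Printing Implicit Defensive.

Import Order.TTheory GRing.Theory Num.Theory.
Import numFieldTopology.Exports.

Local Open Scope classical_set_scope.
Local Open Scope ring_scope.
Local Open Scope card_scope.

(* A subgroup is given by a membership predicate [S : zmodClosed G]; this is
   the subgroup seen as an abelian group in its own right. *)
Record subgroup (G : zmodType) (S : zmodClosed G) : Type :=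
  Subgroup { subgroup_val : G; subgroup_valP : subgroup_val \in S }.

Section SubgroupZmod.
Variables (G : zmodType) (S : zmodClosed G).
HB.instance Definition _ := [isSub for @subgroup_val G S].
HB.instance Definition _ := [Choice of subgroup S by <:].
HB.instance Definition _ := [SubChoice_isSubZmodule of subgroup S by <:].
End SubgroupZmod.

Definition bounded_group (G : zmodType) : Prop :=
  exists2 n : nat, (0 < n)%N & forall x : G, x *+ n = 0.

Definition card_lt T U (A : set T) (B : set U) : Prop :=
  (A #<= B) /\ ~ (A #= B).

Definition lt_continuum T (A : set T) : Prop := card_lt A [set: nat -> bool].

(* Topologies as first-class objects, so that one can quantify over the
   topologies of a fixed type and compare them. *)
Record topology_on (T : Type) := TopologyOn {
  topen : set (set T);
  topenT : topen setT;
  topenI : setI_closed topen;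
  topen_bigU : forall F : set (set T),
    F `<=` topen -> topen (\bigcup_(U in F) U) }.

Definition topologized (G : zmodType) (t : topology_on G) : Type := G.

Section Topologized.
Variables (G : zmodType) (t : topology_on G).

Lemma topen_bigcup (I : Type) (f : I -> set (topologized t)) :
  (forall i, topen t (f i)) -> topen t (\bigcup_i f i).
Proof.
move=> openf; have := @topen_bigU _ t (range f).
by rewrite bigcup_image; apply=> _ [i _ <-].
Qed.

HB.instance Definition _ := GRing.Zmodule.on (topologized t).
HB.instance Definition _ := isOpenTopological.Build (topologized t)
  (topenT t) (@topenI _ t) topen_bigcup.
End Topologized.

(* No separation axiom is included. *)
Record group_topology (G : zmodType) := GroupTopology {
  gtopology :> topology_on G;
  gtopology_sub_continuous : continuous
    (fun x : topologized gtopology * topologized gtopology => x.1 - x.2) }.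

Definition tgroup (G : zmodType) (tau : group_topology G) : Type :=
  topologized tau.

Section TGroup.
Variables (G : zmodType) (tau : group_topology G).
HB.instance Definition _ := GRing.Zmodule.on (tgroup tau).
HB.instance Definition _ := Topological.on (tgroup tau).
HB.instance Definition _ :=
  PreTopologicalNmodule_isTopologicalZmodule.Build (tgroup tau)
    (@gtopology_sub_continuous G tau).
End TGroup.

Definition discrete_group (X : topologicalType) : Prop :=
  @nbhs X X = principal_filter.

Definition nbhs_basis (X : topologicalType) (x : X) (B : set (set X)) : Prop :=
  (forall U, B U -> nbhs x U) /\
  (forall W, nbhs x W -> exists2 U, B U & U `<=` W).

Definition symmetric_set (G : zmodType) (U : set G) : Prop :=
  forall x, U x -> U (- x).

(* the set (1/n)U *)
Definition frac (G : zmodType) (n : nat) (U : set G) : set G :=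
  [set x | forall k : nat, (1 <= k <= n)%N -> U (x *+ k)].

Definition fracs (G : zmodType) (U : set G) : set (set G) :=
  [set frac n U | n in [set n : nat | (0 < n)%N]].

(* The group topology in the definition of a GTG set is a priori unrelated to
   any topology already carried by [G]. *)
Definition GTG_set (G : zmodType) (U : set G) : Prop :=
  [/\ symmetric_set U, U 0 &
      exists sigma : group_topology G,
        nbhs_basis (0 : tgroup sigma) (fracs U)].

Definition locally_GTG (X : topologicalZmodType) : Prop :=
  hausdorff_space X /\
  exists2 B : set (set X), nbhs_basis (0 : X) B & forall U, B U -> GTG_set U.

Definition UFSS (X : topologicalZmodType) : Prop :=
  hausdorff_space X /\
  exists U : set X,
    [/\ symmetric_set U, nbhs (0 : X) U & nbhs_basis (0 : X) (fracs U)].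

Definition locally_minimal (X : topologicalZmodType) : Prop :=
  hausdorff_space X /\
  exists2 V : set X, nbhs (0 : X) V &
    forall sigma : group_topology X,
      topen sigma `<=` (open : set (set X)) ->
      hausdorff_space (tgroup sigma) ->
      nbhs (0 : tgroup sigma) V ->
      topen sigma = (open : set (set X)).

Definition Zsub (R : realType) : {pred R} := [pred x | x \is a Num.int].

Lemma Zsub_zmod_closed (R : realType) : zmod_closed (@Zsub R).
Proof.
by split=> [|x y xZ yZ]; rewrite unfold_in; [exact: rpred0|exact: rpredB].
Qed.

HB.instance Definition _ (R : realType) :=
  GRing.isZmodClosed.Build R (@Zsub R) (@Zsub_zmod_closed R).

(* The circle group T = R/Z, with the quotient group structure and the
   quotient topology. *)
Definition circle (R : realType) : Type :=
  quotient_topology ({ideal_quot @Zsub R}).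

Section Circle.
Variable R : realType.
Local Notation Z := (@Zsub R : zmodClosed R).
HB.instance Definition _ := Topological.on (circle R).
HB.instance Definition _ := Quotient.on (circle R).
HB.instance Definition _ := GRing.isZmodule.Build (circle R)
  (@Quotient.addqA R Z) (@Quotient.addqC R Z)
  (@Quotient.add0q R Z) (@Quotient.addNq R Z).
End Circle.

Definition circle_proj (R : realType) : R -> circle R :=
  (\pi_(circle R))%qT.

Definition circle_plus (R : realType) : set (circle R) :=
  circle_proj (R := R) @` `[- (1 / 4), 1 / 4].

Definition quasi_convex (R : realType) (X : topologicalZmodType) (A : set X) :
    Prop :=
  forall x, ~ A x ->
    exists chi : {additive X -> circle R},
      [/\ continuous chi, chi @` A `<=` @circle_plus R &
          ~ circle_plus (chi x)].

Definition locally_quasi_convex (R : realType) (X : topologicalZmodType) :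
    Prop :=
  exists2 B : set (set X), nbhs_basis (0 : X) B &
    forall U, B U -> quasi_convex R U.

(* Main.v *)
(* (a) => (b): in a UFSS group, the sets (1/n)U are GTG, and any coarser group
   topology for which U is a neighborhood of 0 already contains all of them; a
   countable group is smaller than the continuum by Cantor's theorem.

   (b) => (c): given characters chi_j, separating the points of a group, and
   nonzero elements on which all the chi_j are uniformly small, the set of the h
   with chi_j(h) in T_+ for all j generates a non-discrete locally quasi-convex
   UFSS topology.  If x has infinite order, use Z x with chi_j(k x) = k / j! and
   the elements n! x.  If G is torsion and unbounded, choose inductively x_n
   whose order m_n modulo H_n = <x_i, i < n> exceeds n + 1; let chi_j vanish on
   H_j, take the value 1/m_j at x_j, and extend it step by step to the x_n,
   n > j, with values of norm at most 1/m_n, which is possible since T is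
   divisible.

   (c) => (a): in a bounded group of exponent N, the set (1/N)U is a subgroup
   whenever U is GTG, so that 0 has a basis of open subgroups.  Let F be a free
   ultrafilter on the integers.  Local minimality yields an open subgroup K in
   which every sequence F-converges modulo each open subgroup (otherwise the
   open subgroups with this property define a coarser Hausdorff topology), and
   then in which every sequence of elements of prime order p has an F-limit.
   If the topology is not discrete then, for some p, there are elements a_n of
   order p and a decreasing sequence of open subgroups W_n with a_n in W_n but
   not in W_(n+1).  The F-limits of the series of the e_n a_n, for e in
   {0, 1}^N, are distinct, so the group has at least the cardinality of the
   continuum. *)
From HB Require Import structures.
Require Import Defs.
From mathcomp Require Import all_boot all_order all_algebra.
From mathcomp Require Import all_classical all_reals all_analysis.
From mathcomp Require Import zify ring lra.

Set Implicit Arguments.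
Unset Strict Implicit.
Unset Printing Implicit Defensive.

Import Order.TTheory GRing.Theory Num.Theory.
Import numFieldNormedType.Exports.

Local Open Scope classical_set_scope.
Local Open Scope ring_scope.
Local Open Scope card_scope.

(* Otherwise shadowed by the [frac] of mathcomp's fraction.v. *)
Local Notation frac := Defs.frac.

(** * Group topologies *)

Section TopologicalZmoduleNbhs.
Variable X : topologicalZmodType.
Implicit Types (x y : X) (A : set X).

Lemma nbhs_translate x A : nbhs x A <-> nbhs (0 : X) [set h | A (x + h)].
Proof.
split=> [nA|nA].
  have := @add_continuous X (x, 0); rewrite /continuous_at /= addr0.
  move=> /(_ _ nA) [[B C] /= [nB nC] BC].
  apply: filterS nC => h Ch; apply: (BC (x, h)); split=> //=.
  exact: nbhs_singleton.
have := @sub_continuous X (x, x); rewrite /continuous_at /= subrr.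
move=> /(_ _ nA) [[B C] /= [nB nC] BC].
apply: filterS nB => y By.
have := BC (y, x); rewrite /= addrC subrK; apply; split=> //=.
exact: nbhs_singleton.
Qed.

Lemma nbhs0_mulrn (k : nat) A : nbhs (0 : X) A ->
  nbhs (0 : X) [set x | A (x *+ k)].
Proof.
elim: k A => [|k IHk] A nA.
  by apply: filterS (filterT) => x _ /=; rewrite mulr0n; exact: nbhs_singleton.
have := @add_continuous X (0, 0); rewrite /continuous_at /= addr0.
move=> /(_ _ nA) [[B C] /= [nB nC] BC].
apply: filterS (filterI nB (IHk C nC)) => x [Bx Cx] /=.
by rewrite mulrS; exact: (BC (x, x *+ k)).
Qed.

Lemma nbhs0_frac (n : nat) A : nbhs (0 : X) A -> nbhs (0 : X) (frac n A).
Proof.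
move=> nA; elim: n => [|n IHn].
  by apply: filterS filterT => x _ k; rewrite leqn0 => /andP[] /[swap] /eqP->.
apply: filterS (filterI IHn (nbhs0_mulrn n.+1 nA)) => x [fx nx] k /andP[k0].
by rewrite leq_eqVlt ltnS => /orP[/eqP->//|kn]; apply: fx; rewrite k0.
Qed.

Lemma nbhs0_sub A : nbhs (0 : X) A ->
  exists2 B, nbhs (0 : X) B & forall x y, B x -> B y -> A (x - y).
Proof.
move=> nA; have := @sub_continuous X (0, 0); rewrite /continuous_at /= subr0.
move=> /(_ _ nA) [[B C] /= [nB nC] BC].
exists (B `&` C); first exact: filterI.
by move=> x y [Bx _] [_ Cy]; exact: (BC (x, y)).
Qed.

Lemma hausdorff_nbhs0 :
  hausdorff_space X <-> forall x, (forall A, nbhs (0 : X) A -> A x) -> x = 0.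
Proof.
split=> [hX x xA|h0 p q pq].
  apply/esym/hX => A B nA nB; exists x; split; first exact: xA.
  exact: nbhs_singleton.
suff : q - p = 0 by move/subr0_eq.
apply: h0 => A /nbhs0_sub[B nB BA].
have pB : nbhs p [set y | B (y - p)].
  by apply/nbhs_translate; apply: filterS nB => h /=; rewrite addrC addKr.
have qB : nbhs q [set y | B (y - q)].
  by apply/nbhs_translate; apply: filterS nB => h /=; rewrite addrC addKr.
have [y [/= yp yq]] := pq _ _ pB qB.
by have := BA _ _ yp yq; rewrite opprB addrC addrA subrK.
Qed.

Lemma discrete_nbhs0 : nbhs (0 : X) [set 0] -> discrete_group X.
Proof.
move=> n0; rewrite /discrete_group; apply/funext => x; apply/seteqP; split=> A.
  by move=> xA; apply/principal_filterP; exact: (nbhs_singleton xA).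
move=> /principal_filterP Ax; apply/nbhs_translate.
apply: filterS n0 => _ -> /=.
by rewrite addr0.
Qed.

End TopologicalZmoduleNbhs.

(** * Group topologies defined by a basis at zero *)

Section GroupTopologyOfBase.
Variables (G : zmodType) (B : set (set G)).
Hypothesis B_neq0 : B !=set0.
Hypothesis BI : forall U V, B U -> B V -> exists2 W, B W & W `<=` U `&` V.
Hypothesis B0 : forall U, B U -> U 0.
Hypothesis BB : forall U, B U ->
  exists2 V, B V & forall x y, V x -> V y -> U (x - y).

Let base_open : set (set G) := [set O |
  forall x, O x -> exists2 U, B U & forall h, U h -> O (x + h)].

Let base_openT : base_open setT.
Proof. by move=> x _; have [U BU] := B_neq0; exists U. Qed.

Let base_openI : setI_closed base_open.
Proof.
move=> O P oO oP x [/oO[U BU UO] /oP[V BV VP]].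
have [W BW WUV] := BI BU BV.
by exists W => // h /WUV [Uh Vh]; split; [exact: UO|exact: VP].
Qed.

Let base_open_bigU (F : set (set G)) :
  F `<=` base_open -> base_open (\bigcup_(U in F) U).
Proof.
move=> Fo x [P FP /(Fo _ FP)[U BU UP]].
by exists U => // h /UP Ph; exists P.
Qed.

Let base_topology := TopologyOn base_openT base_openI base_open_bigU.

Let base_nbhs (x : topologized base_topology) (A : set G) :
  nbhs x A <-> exists2 U, B U & forall h, U h -> A (x + h).
Proof.
split=> [[P [oP Px PA]]|[U BU UA]].
  by have [U BU UP] := oP x Px; exists U => // h /UP /PA.
(* The witness is the interior of [A]. Its openness uses [BB] twice: the second use gives opposites,
   so that [h + k = h - (- k)] falls under the first. *)
exists [set y | exists2 V, B V & forall h, V h -> A (y + h)].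
split; [|by exists U|].
- move=> y [V BV VA]; have [W BW WV] := BB BV.
  have [W' BW' W'W] := BB BW.
  exists W' => // h W'h; exists W' => // k W'k.
  rewrite -addrA; apply: VA; rewrite -(opprK k); apply: WV.
    by rewrite -(subr0 h); apply: W'W => //; exact: B0.
  by rewrite -sub0r; apply: W'W => //; exact: B0.
- by move=> y [V BV VA]; rewrite -(addr0 y); apply: VA; exact: B0.
Qed.

Let base_sub_continuous : continuous (fun x :
  topologized base_topology * topologized base_topology => x.1 - x.2).
Proof.
move=> [x y] A /= /base_nbhs[U BU UA]; have [V BV VU] := BB BU.
exists ([set z | V (z - x)], [set z | V (z - y)]) => /=.
  by split; apply/base_nbhs; exists V => // h; rewrite /= addrC addKr.
move=> [z t] /= [Vz Vt]; have -> : z - t = x - y + ((z - x) - (t - y)).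
  by rewrite opprB addrACA [x + _]addrC subrK addKr.
by apply: UA; exact: VU.
Qed.

Lemma group_topology_of_base :
  exists tau : group_topology G, nbhs_basis (0 : tgroup tau) B.
Proof.
exists (GroupTopology base_sub_continuous); split=> [U BU|W].
  by apply/base_nbhs; exists U => // h; rewrite add0r.
move/base_nbhs => [U BU UW]; exists U => // h /UW.
by rewrite add0r.
Qed.

End GroupTopologyOfBase.

Lemma topen_sub_open (X : topologicalZmodType) (sigma : group_topology X)
    (B : set (set X)) :
  nbhs_basis (0 : tgroup sigma) B -> (forall U, B U -> nbhs (0 : X) U) ->
  topen sigma `<=` (open : set (set X)).
Proof.
move=> [_ sB] Bn O oO; rewrite openE => x Ox; apply/nbhs_translate.
have xO : nbhs (x : tgroup sigma) O by rewrite nbhsE; exists O.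
have [U /Bn nU UO] := sB _ ((nbhs_translate _ _).1 xO).
exact: filterS nU.
Qed.

(** * UFSS groups *)

Section Frac.
Variable G : zmodType.
Implicit Types U V : set G.

Lemma frac_subset n U : (0 < n)%N -> frac n U `<=` U.
Proof. by move=> n0 x /(_ 1%N); rewrite mulr1n; apply; rewrite n0. Qed.

Lemma frac_le m n U : (m <= n)%N -> frac n U `<=` frac m U.
Proof.
by move=> mn x xU k /andP[k0 km]; apply: xU; rewrite k0 (leq_trans km).
Qed.

Lemma fracS n U V : U `<=` V -> frac n U `<=` frac n V.
Proof. by move=> UV x xU k /xU /UV. Qed.

Lemma frac_0 n U : U 0 -> frac n U 0.
Proof. by move=> U0 k _; rewrite mul0rn. Qed.

Lemma frac_symmetric n U : symmetric_set U -> symmetric_set (frac n U).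
Proof. by move=> symU x xU k /xU; rewrite mulNrn => /symU. Qed.

Lemma fracs_neq0 U : fracs U !=set0.
Proof. by exists (frac 1 U), 1%N. Qed.

Lemma fracsI U A B : fracs U A -> fracs U B ->
  exists2 C, fracs U C & C `<=` A `&` B.
Proof.
move=> [m /= m0 <-] [n /= n0 <-]; exists (frac (maxn m n) U).
  by exists (maxn m n) => //=; rewrite leq_max m0.
by move=> x xU; split; apply: frac_le xU; [exact: leq_maxl|exact: leq_maxr].
Qed.

End Frac.

Section FracsNbhs.
Variable X : topologicalZmodType.
Implicit Type U : set X.

Lemma fracs_nbhs_basis n U : (0 < n)%N ->
  nbhs_basis (0 : X) (fracs U) -> nbhs_basis (0 : X) (fracs (frac n U)).
Proof.
move=> n0 [nU sU]; split=> [_ [m _ <-]|W /sU[_ [m m0 <-] mW]].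
  by apply: nbhs0_frac; apply: nU; exists n.
exists (frac m (frac n U)); first by exists m.
by move=> x /(fracS (frac_subset n0)) /mW.
Qed.

(** The ambient topology is the required one; it is rebuilt from the basis [fracs U] to obtain a
    [group_topology]. *)
Lemma GTG_set_of_fracs U : symmetric_set U ->
  nbhs_basis (0 : X) (fracs U) -> GTG_set U.
Proof.
move=> symU [nU sU]; have f0 A : fracs U A -> A 0.
  by move=> /nU; exact: nbhs_singleton.
split=> //.
  by apply: (@frac_subset _ 1%N) => //; apply: f0; exists 1%N.
apply: group_topology_of_base => //; first exact: fracs_neq0.
  exact: fracsI.
move=> A /nU /nbhs0_sub[B /sU[C fC CB] BA].
by exists C => // x y /CB Bx /CB By; exact: BA.
Qed.

Lemma UFSS_locally_GTG : UFSS X -> locally_GTG X.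
Proof.
move=> [hX [U [symU nU bU]]]; split=> //; exists (fracs U) => // _ [n n0 <-].
by apply: GTG_set_of_fracs; [exact: frac_symmetric|exact: fracs_nbhs_basis].
Qed.

Lemma UFSS_locally_minimal : UFSS X -> locally_minimal X.
Proof.
move=> [hX [U [symU nU [bn bs]]]]; split=> //; exists U => // sigma so _ sU.
apply/seteqP; split=> // W oW.
suff : open (W : set (tgroup sigma)) by [].
rewrite openE => x Wx; apply/nbhs_translate.
have xW : nbhs (x : X) W by apply: open_nbhs_nbhs.
have [_ [n _ <-] nW] := bs _ ((nbhs_translate _ _).1 xW).
exact: (@filterS (tgroup sigma) _ (nbhs_filter (0 : tgroup sigma)) _ _ nW
  (@nbhs0_frac (tgroup sigma) n U sU)).
Qed.

End FracsNbhs.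

Lemma card_leT_cantor : ~ ([set: nat -> bool] #<= [set: nat]).
Proof.
move=> /pcard_leTP; rewrite injPex => -[f fI].
(* Diagonal function: [D n] holds when [n] is the code of a function that is false at [n].
   Evaluating [D] at its own code is contradictory. *)
pose D n := `[< exists2 g : nat -> bool, f g = n & ~~ g n >].
have [DD|/negP DD] := boolP (D (f D)).
  have /asboolP[g fg] := DD.
  by have -> : g = D by [apply: fI; rewrite ?inE]; rewrite DD.
by apply: (DD); apply/asboolP; exists D => //; apply/negP.
Qed.

Lemma countable_lt_continuum T (A : set T) : countable A -> lt_continuum A.
Proof.
move=> cA; split.
  apply: card_le_trans cA _; apply/pcard_leTP; rewrite injPex.
  exists (fun m n => m == n) => // m n _ _ /(congr1 (fun f => f m)).
  by rewrite eqxx => /esym/eqP.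
move=> /card_eqP AB; apply: card_leT_cantor; apply: card_le_trans cA.
by move: AB => /card_eqP; rewrite card_eq_le => /andP[].
Qed.

(** * Topologies generated by characters *)

Section Circle.
Variable R : realType.
Implicit Types (x y e : R) (t u : circle R).

Local Notation proj := (@circle_proj R).

Lemma circle_projB : {morph proj : x y / x - y}.
Proof.
move=> x y; rewrite /circle_proj.
exact: (raddfB (\pi_({ideal_quot @Zsub R})%qT
                : {additive R -> {ideal_quot @Zsub R}})).
Qed.

Lemma circle_proj_surj t : exists x, t = proj x.
Proof. by exists (repr t); rewrite /circle_proj reprK. Qed.

Lemma circle_proj_eq x y : proj x = proj y <-> x - y \is a Num.int.
Proof.
have := @Quotient.idealrBE R (@Zsub R) x y; rewrite unfold_in /= => ->.
by split=> [xy|/eqP xy]; [apply/eqP|]; exact: xy.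
Qed.

Lemma circle_proj0 : proj 0 = 0.
Proof. by rewrite -(subrr 0) circle_projB subrr. Qed.

Lemma circle_projN : {morph proj : x / - x}.
Proof. by move=> x; rewrite -sub0r circle_projB circle_proj0 sub0r. Qed.

Lemma circle_projD : {morph proj : x y / x + y}.
Proof.
by move=> x y; rewrite -{1}(opprK y) circle_projB circle_projN opprK.
Qed.

Lemma circle_projMn (n : nat) : {morph proj : x / x *+ n}.
Proof.
move=> x; elim: n => [|n IHn]; first by rewrite !mulr0n circle_proj0.
by rewrite !mulrS circle_projD IHn.
Qed.

Lemma circle_proj_eq0 x : proj x = 0 <-> x \is a Num.int.
Proof. by rewrite -circle_proj0 circle_proj_eq subr0. Qed.

(** The radius 1/(4n) makes this (1/n)T_+ for positive [n]; for [n = 0] it is {0}, since the inverse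
    of 0 is 0. *)
Definition circle_ball (n : nat) : set (circle R) :=
  [set proj x | x in [set x | `|x| <= (4 * n%:R)^-1]].

Lemma circle_plusE : @circle_plus R = circle_ball 1.
Proof.
rewrite /circle_plus /circle_ball mulr1; congr (_ @` _).
by apply/seteqP; split=> x /=; rewrite in_itv /= ler_norml div1r.
Qed.

(* If x and (n+1)x - k are small, the integer k must vanish, so each further
   multiple in T_+ improves the bound on a representative. *)
Lemma circle_ball_frac n t : (0 < n)%N ->
  frac n (@circle_plus R) t <-> circle_ball n t.
Proof.
rewrite circle_plusE => n0; split; last first.
  move=> [x /= xn <-] k /andP[k0 kn]; rewrite -circle_projMn.
  exists (x *+ k) => //=.
  rewrite normrMn mulr1 -(mulr_natr `|x|).
  have kn' : k%:R <= n%:R :> R by rewrite ler_nat.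
  have n0' : 0 < n%:R :> R by rewrite ltr0n.
  rewrite invfM in xn; rewrite ler_pdivlMr // in xn.
  by apply: le_trans xn; rewrite ler_wpM2l.
elim: n n0 => // -[_ _|n IHn _ tn].
  by move=> /(_ 1%N); rewrite mulr1n; apply.
have {IHn} [|x /= xn tx] := IHn isT; first by apply: frac_le tn.
have [y /= yn] := tn n.+2 (leqnn _).
rewrite -tx -circle_projMn => /circle_proj_eq /intrP[k yk].
suff k0 : k = 0.
  exists x => //=; move: yk; rewrite k0 => /subr0_eq yx; move: yn.
  rewrite yx normrMn mulr1 -(mulr_natr `|x|) invfM ler_pdivlMr ?ltr0n//.
have n0 : 0 < n.+1%:R :> R by rewrite ltr0n.
have : `|k%:~R| < 1 :> R.
  rewrite -yk (le_lt_trans (ler_normB _ _))// normrMn -(mulr_natr `|x|).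
  rewrite invfM ler_pdivlMr // in xn; rewrite mulr1 in yn.
  have : `|x| <= 4^-1.
    by apply: le_trans xn; rewrite ler_peMr// ler1n.
  by rewrite -(addn1 n.+1) natrD mulrDr; lra.
by rewrite -intr_norm -[1]/(1%:~R) ltr_int; lia.
Qed.
Lemma circle_ballB n t u :
  circle_ball n.*2 t -> circle_ball n.*2 u -> circle_ball n (t - u).
Proof.
move=> [x /= xn <-] [y /= yn <-]; exists (x - y) => /=; last first.
  exact: circle_projB.
rewrite (le_trans (ler_normB _ _))// (le_trans (lerD xn yn))// -mul2n natrM.
by rewrite mulrCA invfM; lra.
Qed.

Lemma circle_ball_opp n t : circle_ball n t -> circle_ball n (- t).
Proof.
by move=> [x /= xn <-]; exists (- x); rewrite /= ?normrN// circle_projN.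
Qed.

Lemma circle_ball0 n : circle_ball n 0.
Proof.
by exists 0; [rewrite /= normr0 invr_ge0 mulr_ge0|exact: circle_proj0].
Qed.

(** Two representatives of [t] of absolute value at most 1/4 differ by an integer smaller than 1, so
    they coincide; a single representative thus meets all the bounds. *)
Lemma circle_ball_eq0 t : (forall n, (0 < n)%N -> circle_ball n t) -> t = 0.
Proof.
move=> tn; have [x /= x1 xt] := tn 1%N isT; rewrite mulr1 in x1.
suff x0 : x = 0 by rewrite -xt x0 circle_proj0.
apply/eqP; rewrite -normr_le0; apply/ler_addgt0Pr => e e0; rewrite add0r.
have [n ne] : exists n, e^-1 < n.+1%:R.
  exists (Num.truncn e^-1); rewrite -(addn1 (Num.truncn _)) addn1.
  exact: truncnS_gt.
have [y /= yn yt] := tn n.+1 isT.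
have yn' : `|y| <= n.+1%:R^-1.
  apply: le_trans yn _; rewrite lef_pV2 ?posrE ?mulr_gt0 ?ltr0n//.
  by rewrite ler_peMl// ler1n.
have yx : y = x.
  have /intrP[k yxk] : y - x \is a Num.int by apply/circle_proj_eq; rewrite yt.
  suff k0 : k = 0 by apply/subr0_eq; rewrite yxk k0.
  have : `|k%:~R| < 1 :> R.
    rewrite -yxk (le_lt_trans (ler_normB _ _))//.
    have : `|y| <= 4^-1.
      apply: le_trans yn _; rewrite lef_pV2 ?posrE ?mulr_gt0 ?ltr0n//.
      by rewrite ler_peMr// ler1n.
    by lra.
  by rewrite -intr_norm -[1]/(1%:~R) ltr_int; lia.
rewrite -yx (le_trans yn')// -(invrK e) lef_pV2 ?posrE ?invr_gt0 ?ltr0n//.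
exact: ltW.
Qed.

Lemma nbhs_circle t (A : set (circle R)) : nbhs t A ->
  exists2 n, (0 < n)%N & forall u, circle_ball n u -> A (t + u).
Proof.
rewrite nbhsE => -[P [oP Pt PA]]; have [x tx] := circle_proj_surj t.
have : nbhs x (proj @^-1` P).
  apply: open_nbhs_nbhs; split; first exact: oP.
  by rewrite /= -tx.
move=> /nbhs_ballP[e /= e0 xeP].
have [n ne] : exists n, e^-1 < n.+1%:R.
  by exists (Num.truncn e^-1); exact: truncnS_gt.
exists n.+1 => // _ [y /= yn <-]; apply: PA; rewrite tx -circle_projD.
apply: (xeP (x + y)); rewrite /ball /= opprD addNKr normrN.
apply: le_lt_trans yn _; rewrite -(invrK e).
rewrite ltf_pV2 ?posrE ?invr_gt0 ?mulr_gt0 ?ltr0n//.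
by apply: lt_le_trans ne _; rewrite ler_peMl// ler1n.
Qed.
End Circle.

(** These multiples witness quasi-convexity: a point outside (1/n)U has a multiple by some [k <= n]
    that one of the characters sends outside T_+. *)
Definition additive_muln (G : zmodType) (R : realType)
  (chi : {additive G -> circle R}) (k : nat) (h : G) : circle R := chi h *+ k.

Section AdditiveMuln.
Variables (G : zmodType) (R : realType).
Variables (chi : {additive G -> circle R}) (k : nat).

Fact additive_muln_is_zmod_morphism : zmod_morphism (additive_muln chi k).
Proof. by move=> x y; rewrite /additive_muln raddfB mulrnBl. Qed.

HB.instance Definition _ := GRing.isZmodMorphism.Build G (circle R)
  (additive_muln chi k) additive_muln_is_zmod_morphism.
End AdditiveMuln.

(** * The topology defined by a sequence of characters *)

Section CharacterTopology.
Variables (R : realType) (G : zmodType) (chi : nat -> {additive G -> circle R}).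
Hypothesis chi_inj : forall h, (forall j, chi j h = 0) -> h = 0.
Hypothesis chi_small : forall n, (0 < n)%N ->
  exists2 h, h != 0 & forall j, circle_ball n (chi j h).

Let U : set G := [set h | forall j, @circle_plus R (chi j h)].

Let frac_U n h : (0 < n)%N -> frac n U h <-> forall j, circle_ball n (chi j h).
Proof.
move=> n0; split=> [hU j|hn k kn j].
  by apply/circle_ball_frac => // k /hU /(_ j); rewrite raddfMn.
by rewrite raddfMn; apply: (circle_ball_frac _ n0).2 kn.
Qed.

(** Membership in (1/n)U places all the characters in the ball of index [n] at once, so doubling [n]
    controls differences. Then [chi_inj] gives the Hausdorff property and [chi_small]
    non-discreteness. *)
Lemma character_topology : exists tau : group_topology G,
  [/\ ~ discrete_group (tgroup tau),
      locally_quasi_convex R (tgroup tau) &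
      UFSS (tgroup tau)].
Proof.
have symU : symmetric_set U.
  move=> h; rewrite /U /= circle_plusE => hU j.
  by rewrite raddfN; exact: circle_ball_opp.
have U0 : U 0.
  by rewrite /U /= circle_plusE => j; rewrite raddf0; exact: circle_ball0.
have [||||tau [tU Ut]] := @group_topology_of_base G (fracs U).
- exact: fracs_neq0.
- exact: fracsI.
- by move=> _ [n _ <-]; exact: frac_0.
- move=> _ [n n0 <-]; have n20 : (0 < n.*2)%N by rewrite double_gt0.
  exists (frac n.*2 U); first by exists n.*2.
  move=> x y /(frac_U _ n20) xU /(frac_U _ n20) yU; apply/frac_U => // j.
  by rewrite raddfB; exact: circle_ballB.
exists tau; split.
- move=> dtau; have : nbhs (0 : tgroup tau) [set 0].
    by rewrite /discrete_group in dtau; rewrite dtau; apply/principal_filterP.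
  move=> /Ut[_ [n n0 <-] nU]; have [h h0 hn] := chi_small n0.
  by move/eqP: h0; apply; apply: nU; apply/frac_U.
- exists (fracs U) => // _ [n n0 <-] x xU.
  have [j [k [k0 kn xkj]]] : exists j k,
      [/\ (0 < k)%N, (k <= n)%N & ~ circle_plus (chi j x *+ k)].
    apply: contrapT => xP; apply: xU => k /andP[k0 kn] j.
    apply: contrapT => xkj.
    by apply: xP; exists j, k; split=> //; rewrite -raddfMn.
  pose chik : {additive G -> circle R} := additive_muln (chi j) k.
  exists chik; split.
  (* On (1/(mk))U the character [chi j] takes values in (1/(mk))T_+, so its multiple by [k] takes
     values in (1/m)T_+. *)
  + move=> y A /nbhs_circle[m m0 mA]; apply/nbhs_translate.
    have mk0 : (0 < m * k)%N by rewrite muln_gt0 m0.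
    have fn : nbhs (0 : tgroup tau) (frac (m * k) U).
      by apply: tU; exists (m * k)%N.
    apply: filterS fn => h /(frac_U _ mk0)/(_ j)/(circle_ball_frac _ mk0) hmk.
    change (A ((chi j (y + h)) *+ k)); rewrite raddfD mulrnDl.
    apply: mA; apply/circle_ball_frac => // i /andP[i0 im].
    by rewrite -mulrnA mulnC; apply: hmk; rewrite muln_gt0 i0 k0 leq_mul.
  + move=> _ [h hU <-]; rewrite /= /additive_muln -raddfMn.
    by apply: hU; rewrite k0.
  + exact: xkj.
- split; first apply/hausdorff_nbhs0 => h hU.
    apply: chi_inj => j; apply: circle_ball_eq0 => n n0.
    by apply: (frac_U h n0).1; apply: hU; apply: tU; exists n.
  exists U; split=> //; apply: filterS (tU (frac 1 U) _); last by exists 1%N.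
  exact: frac_subset.
Qed.

End CharacterTopology.

(** * Characters on the image of a homomorphism *)

Definition img_pred (P G : zmodType) (ev : {additive P -> G}) : {pred G} :=
  fun h => `[< exists p, ev p = h >].

Section Image.
Variables (P G : zmodType) (ev : {additive P -> G}).

Fact img_zmod_closed : zmod_closed (img_pred ev).
Proof.
split=> [|x y /asboolP[p <-] /asboolP[q <-]]; apply/asboolP.
  by exists 0; rewrite raddf0.
by exists (p - q); rewrite raddfB.
Qed.

HB.instance Definition _ := GRing.isZmodClosed.Build G (img_pred ev)
  img_zmod_closed.

Definition img_preim (h : subgroup (img_pred ev)) : P :=
  projT1 (cid (asboolW (subgroup_valP h))).

Lemma img_preimK h : ev (img_preim h) = \val h.
Proof. by rewrite /img_preim; case: cid. Qed.

End Image.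

Definition int_on_ker (R : realType) (P G : zmodType)
    (ev : {additive P -> G}) (L : {additive P -> R}) :=
  forall p, ev p = 0 -> L p \is a Num.int.

(** Integrality on the kernel makes the class of the real lift modulo Z independent of the chosen
    preimage. *)
Definition img_character (R : realType) (P G : zmodType)
    (ev : {additive P -> G}) (L : {additive P -> R})
    (_ : int_on_ker ev L) (h : subgroup (img_pred ev)) : circle R :=
  circle_proj (L (img_preim h)).

Section ImageCharacter.
Variables (R : realType) (P G : zmodType) (ev : {additive P -> G}).
Variables (L : {additive P -> R}) (evL : int_on_ker ev L).

Lemma img_characterE p h :
  ev p = \val h -> img_character evL h = circle_proj (L p).
Proof.
move=> ph; apply/circle_proj_eq; rewrite -raddfB; apply: evL.
by rewrite raddfB ph img_preimK subrr.
Qed.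

Fact img_character_is_zmod_morphism : zmod_morphism (img_character evL).
Proof.
move=> x y; rewrite /img_character -circle_projB -raddfB.
by apply: img_characterE; rewrite raddfB !img_preimK.
Qed.

HB.instance Definition _ := GRing.isZmodMorphism.Build
  (subgroup (img_pred ev)) (circle R) (img_character evL)
  img_character_is_zmod_morphism.

End ImageCharacter.

Definition small_countable_subgroup (R : realType) (G : zmodType) :=
  exists S : zmodClosed G, countable [set: subgroup S] /\
    exists tau : group_topology (subgroup S),
      [/\ ~ discrete_group (tgroup tau),
          locally_quasi_convex R (tgroup tau) &
          UFSS (tgroup tau)].

(** In the first hypothesis, the direct implication lets the lifts [L j] descend to the image and
    the converse makes the resulting characters separate points. *)
Lemma image_topology (R : realType) (P : countZmodType) (G : zmodType)
    (ev : {additive P -> G}) (L : nat -> {additive P -> R}) :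
  (forall p, ev p = 0 <-> forall j, L j p \is a Num.int) ->
  (forall n, (0 < n)%N -> exists2 p, ev p != 0 &
     forall j, circle_ball n (circle_proj (L j p))) ->
  small_countable_subgroup R G.
Proof.
move=> kerE small; pose S : zmodClosed G := img_pred ev; exists S; split.
  apply/pcard_leTP; rewrite injPex; exists (fun h => pickle (img_preim h)).
  move=> h k _ _ /(pcan_inj pickleK) hk; apply: val_inj.
  by rewrite -!img_preimK hk.
have evL j : int_on_ker ev (L j) by move=> p /kerE.
pose chi j : {additive subgroup S -> circle R} := img_character (evL j).
apply: (@character_topology R (subgroup S) chi).
- move=> h h0; apply: val_inj; rewrite -img_preimK [RHS]raddf0.
  by apply/kerE => j; apply/circle_proj_eq0; exact: h0.
- move=> n n0; have [p p0 pn] := small n n0.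
  have pS : ev p \in img_pred ev by apply/asboolP; exists p.
  exists (Subgroup pS) => [|j].
    by apply: contra p0 => /eqP/(congr1 val); rewrite [RHS]raddf0 /= => ->.
  by rewrite /= (@img_characterE _ _ _ _ _ _ p).
Qed.

Definition intmul_at (V : zmodType) (v : V) (k : int) : V := v *~ k.

Section IntmulAt.
Variables (V : zmodType) (v : V).

Fact intmul_at_is_zmod_morphism : zmod_morphism (intmul_at v).
Proof. by move=> k l; exact: mulrzBr. Qed.

HB.instance Definition _ := GRing.isZmodMorphism.Build int V (intmul_at v)
  intmul_at_is_zmod_morphism.
End IntmulAt.

Lemma nontorsion_small_subgroup (R : realType) (G : zmodType) (x : G) :
  (forall n, (0 < n)%N -> x *+ n != 0) -> small_countable_subgroup R G.
Proof.
move=> xn; have x0 (k : int) : x *~ k = 0 -> k = 0.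
  case: k => [[|k]|k] //.
    by move=> /eqP; rewrite -pmulrn; rewrite (negbTE (xn _ _)).
  by move=> /eqP; rewrite NegzE mulrNz oppr_eq0 -pmulrn (negbTE (xn _ _)).
have fact0 j : 0 < j`!%:R :> R by rewrite ltr0n fact_gt0.
apply: (@image_topology R int G (intmul_at x)
          (fun j => intmul_at (j`!%:R^-1 : R))).
- move=> k; split=> [/x0 -> j|kj]; first by rewrite raddf0 rpred0.
  suff -> : k = 0 by rewrite raddf0.
  (* At j = |k| + 1 the factorial exceeds |k|, so [k] is an integer multiple of it only if [k] is
     0. *)
  have := kj (`|k|%N.+1); rewrite /= /intmul_at -mulrzl => /intrP[l kl].
  have kl' : k = l * (`|k|%N.+1)`!%:Z.
    by apply: (@intr_inj R); rewrite intrM -kl -pmulrn mulfVK ?gt_eqF.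
  have := fact_geq `|k|.+1; move: kl'; case: (l =P 0) => [->|l0]; first by lia.
  by set f := (_ `!)%N; nia.
(* The character of index j vanishes at (4n)! x when j <= 4n; for larger j its value (4n)!/j! is at
   most 1/j. *)
- move=> n n0; exists (4 * n)`!%:Z.
    by rewrite /= /intmul_at -pmulrn xn ?fact_gt0.
  move=> j; rewrite /= /intmul_at -mulrzl -pmulrn.
  have [j4|j4] := leqP j (4 * n).
    suff -> : circle_proj ((4 * n)`!%:R / j`!%:R : R) = 0.
      exact: circle_ball0.
    apply/circle_proj_eq0; rewrite -(bin_fact j4) mulnCA natrM.
    by rewrite mulrAC divff ?gt_eqF// mul1r natr_int.
  exists ((4 * n)`!%:R / j`!%:R) => //=; rewrite ger0_norm ?divr_ge0//.
  rewrite -natrM ler_pdivrMr// mulrC ler_pdivlMr ?ltr0n ?muln_gt0//.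
  rewrite -natrM ler_nat; case: j j4 => // j; rewrite ltnS => j4.
  by rewrite factS mulnC leq_mul// ?leqW// leq_fact.
Qed.

(** * Unbounded torsion groups *)

(** Integer polynomials stand for finitely supported coefficient sequences, that is, for the
    countable free abelian group with basis the monomials. *)
Definition comb (V : zmodType) (x : nat -> V) (p : {poly int}) : V :=
  \sum_(i < size p) x i *~ p`_i.

Section Comb.
Variables (V : zmodType) (x : nat -> V).

Lemma combE n (p : {poly int}) : (size p <= n)%N ->
  comb x p = \sum_(i < n) x i *~ p`_i.
Proof.
move=> pn; rewrite /comb (big_ord_widen _ (fun i => x i *~ p`_i) pn).
rewrite [LHS]big_mkcond; apply: eq_bigr => i _.
by case: ltnP => // /(nth_default 0) ->; rewrite mulr0z.
Qed.

Fact comb_is_zmod_morphism : zmod_morphism (comb x).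
Proof.
move=> p q; pose n := maxn (size (p : {poly int})) (size (q : {poly int})).
have pqn : (size (p - q : {poly int})%R <= n)%N.
  by rewrite (leq_trans (size_polyD _ _))// size_polyN.
rewrite !(combE (n := n)) ?leq_maxl ?leq_maxr// -sumrB.
by apply: eq_bigr => i _; rewrite coefB mulrzBr.
Qed.

HB.instance Definition _ := GRing.isZmodMorphism.Build {poly int} V (comb x)
  comb_is_zmod_morphism.

Lemma combXn n : comb x 'X^n = x n.
Proof.
rewrite (combE (n := n.+1)) ?size_polyXn// big_ord_recr /= coefXn eqxx mulr1z.
rewrite big1 ?add0r// => i _; rewrite coefXn.
by rewrite ltn_eqF ?ltn_ord// mulr0z.
Qed.

Lemma comb_span_closed n (p q : {poly int}) :
  (size p <= n)%N -> (size q <= n)%N ->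
  exists2 r : {poly int}, (size r <= n)%N & comb x r = comb x p - comb x q.
Proof.
move=> pn qn; exists (p - q); last by rewrite raddfB.
by rewrite (leq_trans (size_polyD _ _))// size_polyN geq_max pn.
Qed.

End Comb.

(** Course-of-values recursion: the iteration carries the list of all values computed so far. *)
Lemma seq_recursion (T : Type) (F : seq T -> T) :
  exists c : nat -> T, forall n, c n = F (mkseq c n).
Proof.
pose s n := iter n (fun s => rcons s (F s)) [::].
exists (fun n => F (s n)) => n; congr F.
by elim: n => // n IHn; rewrite mkseqS -IHn.
Qed.

Lemma torsion_span_exponent (G : zmodType) (s : seq G) :
  (forall y : G, exists2 N, (0 < N)%N & y *+ N = 0) ->
  exists2 N, (0 < N)%N & forall y, y \in s -> y *+ N = 0.
Proof.
move=> torG; elim: s => [|y s [N N0 sN]]; first by exists 1%N.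
have [M M0 yM] := torG y; exists (M * N)%N; first by rewrite muln_gt0 M0.
move=> z; rewrite inE => /orP[/eqP->|/sN zN]; first by rewrite mulrnA yM mul0rn.
by rewrite mulnC mulrnA zN mul0rn.
Qed.

Section Torsion.
Variable G : zmodType.
Hypothesis torG : forall y : G, exists2 N, (0 < N)%N & y *+ N = 0.
Hypothesis unbG : ~ bounded_group G.

Let span (s : seq G) (y : G) :=
  exists2 q : {poly int}, (size q <= size s)%N & y = comb (nth 0 s) q.

(** Otherwise every element has a multiple by some k <= |s| + 1 in the span, and (|s| + 1)! times an
    exponent of [s] annihilates the whole group. *)
Let span_step (s : seq G) : exists y, forall k, (0 < k <= (size s).+1)%N ->
  ~ span s (y *+ k).
Proof.
apply: contrapT => no; apply: unbG.
have [N N0 sN] := torsion_span_exponent s torG.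
exists ((size s).+1`! * N)%N; first by rewrite muln_gt0 fact_gt0.
move=> y.
have [k [kn [q qs ykq]]] :
    exists k, (0 < k <= (size s).+1)%N /\ span s (y *+ k).
  apply: contrapT => yk; apply: no; exists y => k kn ykq.
  by apply: yk; exists k.
have /dvdnP[d ->] : (k %| (size s).+1`!)%N by rewrite dvdn_fact.
rewrite -mulnA mulnC mulrnA mulrnA ykq (combE _ qs) -sumrMnl.
rewrite big1 ?mul0rn// => i _.
by rewrite pmulrn -mulrzA mulrC mulrzA -pmulrn sN ?mul0rz// mem_nth.
Qed.

(** Here [m n] is the order of [x n] modulo the span of the earlier terms, and [w n] records the
    resulting relation. *)
Lemma torsion_independent_sequence :
  exists (x : nat -> G) (m : nat -> nat) (w : nat -> {poly int}),
    [/\ forall n, (n.+1 < m n)%N,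
        forall n, (size (w n) <= n)%N /\ x n *+ m n = comb x (w n) &
        forall n (k : int) (q : {poly int}),
          (size q <= n)%N -> x n *~ k = comb x q ->
          (m n %| k)%Z].
Proof.
have [F FP] := choice span_step; have [x xF] := seq_recursion F.
pose sp n y := exists2 q : {poly int}, (size q <= n)%N & y = comb x q.
have spP n y : sp n y -> span (mkseq x n) y.
  move=> [q qn ->]; exists q; first by rewrite size_mkseq.
  rewrite !(combE _ qn); apply: eq_bigr => i _.
  by rewrite nth_mkseq.
have spB n y z : sp n y -> sp n z -> sp n (y - z).
  move=> [p pn ->] [q qn ->].
  by have [r rn rE] := comb_span_closed x pn qn; exists r.
have sp0 n : sp n 0 by exists 0; rewrite ?size_poly0 ?raddf0.
have spN n y : sp n y -> sp n (- y) by rewrite -sub0r; exact: spB.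
have spMn n y k : sp n y -> sp n (y *+ k).
  move=> yn; elim: k => // k IHk.
  by have := spB _ _ _ IHk (spN _ _ yn); rewrite opprK mulrSr.
have xk n k : (0 < k <= n.+1)%N -> ~ sp n (x n *+ k).
  move=> kn /spP; rewrite {1}xF; apply: FP; rewrite size_mkseq.
  exact: kn.
have /choice[m mP] : forall n, exists m, [/\ (0 < m)%N, sp n (x n *+ m) &
    forall k, (0 < k < m)%N -> ~ sp n (x n *+ k)].
  move=> n; pose Q k := (0 < k)%N && `[< sp n (x n *+ k) >].
  have exQ : exists k, Q k.
    have [N N0 xN] := torG (x n); exists N; rewrite /Q N0; apply/asboolP.
    by rewrite xN.
  case: (ex_minnP exQ) => m0 /andP[m00 /asboolP m0sp] m0min.
  exists m0; split=> // k /andP[k0 km] ksp; have : (m0 <= k)%N.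
    by apply: m0min; rewrite /Q k0; apply/asboolP.
  by rewrite leqNgt km.
have /choice[w wP] : forall n, exists q : {poly int},
    (size q <= n)%N /\ x n *+ m n = comb x q.
  by move=> n; have [_ [q qn qE] _] := mP n; exists q.
exists x, m, w; split=> //.
- move=> n; rewrite ltnNge; apply/negP => mn; have [m0 msp _] := mP n.
  by apply: (@xk n (m n)) => //; rewrite m0.
- move=> n k q qn xkq; have [m0 msp mmin] := mP n.
  (* The remainder of [k] modulo [m n] also gives a multiple of [x n] in the span, so minimality of
     [m n] forces it to be 0. *)
  have [r rk rm] : exists2 r : nat, (k %% m n)%Z = r & (r < m n)%N.
    have km0 : 0 <= (k %% m n)%Z by rewrite modz_ge0// -lt0n.
    have km : (k %% m n)%Z < m n by rewrite ltz_pmod.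
    by exists `|(k %% m n)%Z|%N; lia.
  apply/dvdz_mod0P; rewrite rk.
  case: r => // r in rk rm *; exfalso; apply: (mmin r.+1) => //.
  have -> : x n *+ r.+1 = x n *~ k - x n *+ m n *~ (k %/ m n)%Z.
    rewrite pmulrn -rk [x n *+ m n]pmulrn -mulrzA -mulrzBr; congr (_ *~ _).
    by rewrite {2}(divz_eq k (m n)); ring.
  apply: spB; first by exists q.
  case: (k %/ m n)%Z => d; first by rewrite -pmulrn; exact: spMn.
  by rewrite NegzE mulrNz -pmulrn; apply: spN; exact: spMn.
Qed.

End Torsion.

(** * Characters of the group spanned by the independent sequence *)

Section TorsionCharacters.
Variables (R : realType) (G : zmodType).
Variables (x : nat -> G) (m : nat -> nat) (w : nat -> {poly int}).
Hypothesis m_gt : forall n, (n.+1 < m n)%N.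
Hypothesis size_w : forall n, (size (w n) <= n)%N.
Hypothesis x_m : forall n, x n *+ m n = comb x (w n).
Hypothesis m_dvd : forall n (k : int) (q : {poly int}),
  (size q <= n)%N -> x n *~ k = comb x q -> (m n %| k)%Z.

Let m_gt0 n : (0 < m n)%N. Proof. exact: leq_ltn_trans (m_gt n). Qed.
Let mR_gt0 n : 0 < (m n)%:R :> R. Proof. by rewrite ltr0n. Qed.

Let rel n : {poly int} := 'X^n *+ m n - w n.

Let comb_rel n : comb x (rel n) = 0.
Proof. by rewrite raddfB raddfMn /= combXn x_m subrr. Qed.

Let fract (r : R) : R := r - (Num.floor r)%:~R.

(** The [c n] lift the values of chi_j at the [x n]. For n other than j, dividing a representative
    in [0, 1) by [m n] solves the relation modulo Z with a value below 1/m_n; for n < j this yields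
    0. *)
Lemma torsion_character (j : nat) : exists c : nat -> R, forall n,
  c n = if n == j then (m n)%:R^-1 else fract (comb c (w n)) / (m n)%:R.
Proof.
have [c cE] := seq_recursion (fun s : seq R =>
  if size s == j then (m (size s))%:R^-1
  else fract (comb (nth 0 s) (w (size s))) / (m (size s))%:R).
exists c => n; rewrite [LHS]cE size_mkseq; congr (if _ then _ else fract _ / _).
rewrite !(combE _ (size_w n)); apply: eq_bigr => i _.
by rewrite nth_mkseq.
Qed.

Section Character.
Variables (j : nat) (c : nat -> R).
Hypothesis cE : forall n,
  c n = if n == j then (m n)%:R^-1 else fract (comb c (w n)) / (m n)%:R.

Let c_lt n : (n < j)%N -> c n = 0.
Proof.
elim/ltn_ind: n => n IHn nj; rewrite cE ltn_eqF//.
suff -> : comb c (w n) = 0 by rewrite /fract floor0 subr0 mul0r.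
rewrite (combE _ (size_w n)) big1// => i _.
by rewrite IHn ?mul0rz// (ltn_trans _ nj).
Qed.

Lemma character_bound n : 0 <= c n <= (m n)%:R^-1.
Proof.
have m0 := mR_gt0 n; rewrite cE; case: ifP => _.
  by rewrite lexx invr_ge0 ltW.
have /andP[f0 f1] : 0 <= fract (comb c (w n)) <= 1.
  rewrite /fract subr_ge0 floor_le_tmp /= lerBlDl.
  by apply: ltW; have := floorD1_gt (comb c (w n)); rewrite intrD.
apply/andP; split; first by rewrite divr_ge0 // ltW.
by rewrite ler_piMl // invr_ge0 ltW.
Qed.

Lemma character_rel n : comb c (rel n) \is a Num.int.
Proof.
rewrite raddfB raddfMn /= combXn -(mulr_natr (c n)) {1}cE; have m0 := mR_gt0 n.
case: eqP => [->|_].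
  rewrite mulVf ?gt_eqF//.
  suff -> : comb c (w j) = 0 by rewrite subr0 rpred1.
  by rewrite (combE _ (size_w j)) big1// => i _; rewrite c_lt ?mul0rz.
by rewrite mulfVK ?gt_eqF// /fract addrAC subrr sub0r rpredN intr_int.
Qed.

(** Consequently an integral value forces [m j] to divide the coefficient of index [j]. *)
Lemma character_diag (p : {poly int}) : (size p <= j.+1)%N ->
  comb c p = (p`_j)%:~R / (m j)%:R.
Proof.
move=> pj; rewrite (combE _ pj) big_ord_recr /= big1 ?add0r.
  by rewrite cE eqxx -mulrzl.
by move=> i _; rewrite c_lt ?mul0rz.
Qed.

End Character.

Let rel_reduce n (p : {poly int}) : (size p <= n.+1)%N -> (m n %| p`_n)%Z ->
  exists d : int, (size (p - rel n *~ d)%R <= n)%N.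
Proof.
move=> pn /dvdzP[d pd]; exists d; apply/leq_sizeP => i ni.
rewrite coefB coefMrz /rel coefB coefMn coefXn.
rewrite (nth_default 0 (leq_trans (size_w n) ni)) subr0.
move: ni; rewrite leq_eqVlt => /orP[/eqP <-|ni].
  by rewrite eqxx pd mulrzz natz mulrC subrr.
by rewrite gtn_eqF// mul0rn mul0rz subr0 nth_default// (leq_trans pn).
Qed.

(** The kernel is determined by induction on the size of [p]: either condition forces [m n] to
    divide the coefficient of index [n], by [m_dvd] or by chi_n, and subtracting a multiple of
    [rel n] then removes it while preserving both conditions. *)
Lemma torsion_characters_small : small_countable_subgroup R G.
Proof.
have [c cE] := choice torsion_character.
apply: (@image_topology R {poly int} G (comb x) (fun j => comb (c j))).
- move=> p; move: {2}(size p) (leqnn (size p)) => n.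
  elim: n p => [|n IHn] p pn.
    move: pn; rewrite size_poly_leq0 => /eqP ->.
    by split=> *; rewrite raddf0// rpred0.
  have step d : (size (p - rel n *~ d)%R <= n)%N ->
      comb x p = 0 <-> forall j, comb (c j) p \is a Num.int.
    move=> /IHn; rewrite raddfB raddfMz /= comb_rel mul0rz subr0 => ->.
    split=> cp j; have := cp j; rewrite raddfB raddfMz /=.
      by rewrite rpredBr// rpredMz// (character_rel (cE j)).
    by move=> cpj; rewrite rpredB// rpredMz// (character_rel (cE j)).
  have xpn : comb x p = comb x (p - p`_n *: 'X^n) + x n *~ p`_n.
    rewrite raddfB /= -[in RHS](combXn x n) -raddfMz /= -scaler_int intz.
    by rewrite subrK.
  have spn : (size (p - p`_n *: 'X^n)%R <= n)%N.
    apply/leq_sizeP => i; rewrite coefB coefZ coefXn leq_eqVlt.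
    move=> /orP[/eqP<-|ni].
      by rewrite eqxx mulr1 subrr.
    by rewrite gtn_eqF// mulr0 subr0 nth_default// (leq_trans pn).
  split=> [xp|cp].
    have [|d dn] := rel_reduce pn; last exact: (step d dn).1.
    apply: (@m_dvd n _ (- (p - p`_n *: 'X^n))); first by rewrite size_polyN.
    by rewrite raddfN; apply/eqP; rewrite -addr_eq0 addrC -xpn xp.
  have [|d dn] := rel_reduce pn; last exact: (step d dn).2.
  have := cp n; rewrite /= (character_diag (cE n) pn) => /intrP[k pk].
  apply/dvdzP; exists k; apply: (@intr_inj R).
  by rewrite intrM -pk -pmulrn mulfVK ?gt_eqF.
- move=> n n0; exists 'X^(4 * n).
    rewrite /= combXn; apply/eqP => x0.
    have : (m (4 * n) %| 1)%Z.
      by apply: (@m_dvd _ _ 0); rewrite ?size_poly0// mulr1z x0 raddf0.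
    by have := m_gt (4 * n); rewrite dvdz1 /=; lia.
  move=> j; rewrite /= combXn; exists (c j (4 * n)%N) => //=.
  have /andP[c0 cm] := character_bound (cE j) (4 * n).
  rewrite ger0_norm// (le_trans cm)// -natrM lef_pV2 ?posrE ?ltr0n ?muln_gt0//.
  by rewrite ler_nat ltnW// ltnW.
Qed.

End TorsionCharacters.

Lemma unbounded_small_subgroup (R : realType) (G : zmodType) :
  ~ bounded_group G -> small_countable_subgroup R G.
Proof.
move=> unbG.
have [torG|] := pselect (forall y : G, exists2 N, (0 < N)%N & y *+ N = 0).
  have [x [m [w [m_gt xw m_dvd]]]] := torsion_independent_sequence torG unbG.
  apply: (@torsion_characters_small R G x m w) => // n; first exact: (xw n).1.
  exact: (xw n).2.
move=> /existsNP[y yN]; apply: (@nontorsion_small_subgroup R G y) => n n0.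
by apply/eqP => yn0; apply: yN; exists n.
Qed.

(** * Bounded groups *)

Lemma prime_mul_ind (Q : nat -> Prop) : Q 1%N ->
  (forall q d, prime q -> (0 < d)%N -> Q d -> Q (q * d)%N) ->
  forall n, (0 < n)%N -> Q n.
Proof.
move=> Q1 QM; elim/ltn_ind => n IHn n0.
have [n1|n1] := leqP n 1; first by have -> : n = 1%N by lia.
have pn := pdiv_prime n1; have /dvdnP[d nd] := pdiv_dvd n.
have d0 : (0 < d)%N by move: n0; rewrite nd; case: d {nd}.
rewrite nd mulnC; apply: QM => //; apply: IHn => //.
by rewrite [X in (_ < X)%N]nd ltn_Pmulr// prime_gt1.
Qed.

Lemma ultra_pigeonhole (T : Type) (F : set_system T) (N : nat)
    (E : nat -> T -> Prop) : UltraFilter F ->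
  F [set t | exists2 j, (j < N)%N & E j t] ->
  exists2 j, (j < N)%N & F [set t | E j t].
Proof.
move=> UF; have PF := ultra_proper; elim: N => [|N IHN] FE.
  by have [t [j]] := filter_ex FE.
have [FN|FN] := in_ultra_setVsetC [set t | E N t] UF; first by exists N.
have [|j jN Fj] := IHN; last by exists j => //; exact: leqW.
apply: filterS (filterI FE FN) => t [[j]].
by rewrite ltnS leq_eqVlt => /orP[/eqP->//|jN] Ej _; exists j.
Qed.

Definition is_subgroup (G : zmodType) (A : set G) : Prop :=
  A 0 /\ forall x y, A x -> A y -> A (x - y).

Section IsSubgroup.
Variables (G : zmodType) (A : set G).
Hypothesis sA : is_subgroup A.

Lemma is_subgroup0 : A 0. Proof. by case: sA. Qed.

Lemma is_subgroupB x y : A x -> A y -> A (x - y).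
Proof. by case: sA => _; apply. Qed.

Lemma is_subgroupN x : A x -> A (- x).
Proof. by rewrite -sub0r; apply: is_subgroupB; exact: is_subgroup0. Qed.

Lemma is_subgroupD x y : A x -> A y -> A (x + y).
Proof.
move=> Ax Ay; rewrite -[y]opprK; apply: is_subgroupB => //.
exact: is_subgroupN.
Qed.

Lemma is_subgroupMn x n : A x -> A (x *+ n).
Proof.
move=> Ax; elim: n => [|n IHn]; first exact: is_subgroup0.
by rewrite mulrS; exact: is_subgroupD.
Qed.

Lemma is_subgroupMz x (k : int) : A x -> A (x *~ k).
Proof.
move=> Ax; case: k => n; first by rewrite -pmulrn; exact: is_subgroupMn.
by rewrite NegzE mulrNz -pmulrn; apply: is_subgroupN; exact: is_subgroupMn.
Qed.

End IsSubgroup.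

Lemma is_subgroupI (G : zmodType) (A B : set G) :
  is_subgroup A -> is_subgroup B -> is_subgroup (A `&` B).
Proof.
move=> [A0 AB] [B0 BB]; split=> // x y [Ax Bx] [Ay By].
by split; [exact: AB|exact: BB].
Qed.

(** Multiples depend only on the multiplier modulo [N], so (1/N)U is contained in every (1/n)U. It
    is therefore the least neighborhood of 0, and continuity of subtraction closes it under
    differences. *)
Lemma GTG_bounded_is_subgroup (G : zmodType) (N : nat) (U : set G) :
  (0 < N)%N -> (forall x : G, x *+ N = 0) -> GTG_set U ->
  is_subgroup (frac N U).
Proof.
move=> N0 xN [symU U0 [sigma [nU sU]]].
have fN n : frac N U `<=` frac n U.
  move=> x xU k _; rewrite (divn_eq k N) mulrnDr mulrnA mulrnAC xN mul0rn add0r.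
  have [->|k0] := posnP (k %% N); first by rewrite mulr0n.
  by apply: xU; rewrite k0 ltnW// ltn_mod.
split; first exact: frac_0.
have /nbhs0_sub[B /sU[_ [n n0 <-] nB] BU] : nbhs (0 : tgroup sigma) (frac N U).
  by apply: nU; exists N.
by move=> x y /fN-/(_ n)/nB Bx /fN-/(_ n)/nB By; exact: BU.
Qed.

(** * Maximal subgroups and ultrafilter limits *)

Section MaximalSubgroup.
Variables (G : zmodType) (W : set G) (x : G).
Hypotheses (sW : is_subgroup W) (Wx : ~ W x).

Lemma maximal_subgroup_avoiding : exists M,
  [/\ is_subgroup M, W `<=` M, ~ M x &
      forall y, ~ M y -> exists k : int, M (x - y *~ k)].
Proof.
pose good A := [/\ is_subgroup A, W `<=` A & ~ A x].
have [|A [Agood Amax]] := @Zorn_bigcup G [set A | A = set0 \/ good A].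
  move=> F Fgood Ftot.
  have [[A [FA Agood]]|nogood] := pselect (exists A, F A /\ good A); last first.
    left; apply/seteqP; split=> // y [A FA Ay].
    have [A0|gA] := Fgood A FA; first by rewrite A0 in Ay.
    by apply: nogood; exists A.
  right; have [sA WA Ax] := Agood; split.
  - split; first by exists A => //; exact: is_subgroup0.
    move=> y z [B FB By] [C FC Cz].
    have hB : forall D, F D -> D !=set0 -> good D.
      by move=> D /Fgood[-> [u]|gD _].
    have [BC|CB] := Ftot B C FB FC.
      have [sC _ _] := hB C FC (ex_intro _ z Cz).
      by exists C => //; apply: is_subgroupB => //; exact: BC.
    have [sB _ _] := hB B FB (ex_intro _ y By).
    by exists B => //; apply: is_subgroupB => //; exact: CB.
  - by move=> y /WA Ay; exists A.
  - by move=> [B FB Bx]; case: (Fgood B FB) => [B0|[_ _]//]; rewrite B0 in Bx.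
have {Agood} [sA WA Ax] : good A.
  case: Agood => // A0; exfalso; apply: (Amax W); last by right; split.
  rewrite A0; split=> // W0; exact: (W0 0 (is_subgroup0 sW)).
exists A; split=> // y Ay; apply: contrapT => xy.
apply: (Amax [set z | exists k : int, A (z - y *~ k)]).
  split=> [z Az|/(_ y)]; first by exists 0; rewrite subr0.
  move=> yA; apply: Ay; apply: yA; exists 1.
  by rewrite mulr1z subrr; exact: is_subgroup0.
right; split=> //.
- split; first by exists 0; rewrite subr0; exact: is_subgroup0.
  move=> u v [k uk] [l vl]; exists (k - l).
  have -> : u - v - y *~ (k - l) = (u - y *~ k) - (v - y *~ l).
    by rewrite mulrzBr !opprD !opprK addrACA.
  exact: is_subgroupB.
- by move=> z /WA Az; exists 0; rewrite subr0.
Qed.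

End MaximalSubgroup.

Section UltraSeparation.
Variables (G : zmodType) (N : nat) (F : set_system nat).
Hypotheses (N_gt0 : (0 < N)%N) (xN : forall x : G, x *+ N = 0).
Context {UF : UltraFilter F}.

Let PF : ProperFilter F. Proof. exact: ultra_proper. Qed.

Lemma mulrz_mod_exponent (x : G) (u : int) :
  exists2 j, (j < N)%N & x *~ u = x *+ j.
Proof.
have m0 : 0 <= (u %% N)%Z by rewrite modz_ge0 -?lt0n.
have mN : (u %% N)%Z < N by rewrite ltz_pmod.
exists `|(u %% N)%Z|%N; first by lia.
rewrite [RHS]pmulrn gez0_abs// {1}(divz_eq u N) mulrzDr mulrC mulrzA.
by rewrite -pmulrn xN mul0rz add0r.
Qed.

(* M is maximal among the subgroups avoiding x, so every element of G/M of
   prime order is a multiple of x: there are finitely many of them. *)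
Lemma ultra_separation (W : set G) (x : G) : is_subgroup W -> ~ W x ->
  exists M, [/\ is_subgroup M, W `<=` M, ~ M x &
    forall s : nat -> G, exists c, F [set n | M (s n - c)]].
Proof.
move=> sW Wx; have [M [sM WM Mx maxM]] := maximal_subgroup_avoiding sW Wx.
exists M; split=> // s.
have primeM q y : prime q -> M (y *+ q) ->
    exists2 j, (j < N)%N & M (y - x *+ j).
  move=> qP yq; have [My|/maxM[k xyk]] := pselect (M y).
    by exists 0%N; rewrite ?subr0.
  (* If [q] divided [k], then [y *~ k], and with it [x], would lie in [M]. A Bezout relation then
     makes [y] congruent to a multiple of [x]. *)
  have qk : coprimez q k.
    rewrite coprimezE prime_coprime//=; apply/negP => /dvdnP[d kd]; apply: Mx.
    rewrite -(subrK (y *~ k) x); apply: is_subgroupD => //.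
    have [l ->] : exists l : int, k = q%:Z * l.
      case: (intP k) kd => [|n|n] /= kd.
      - by exists 0; rewrite mulr0.
      - by exists d; rewrite kd; lia.
      - by exists (- d%:Z); rewrite kd; lia.
    by rewrite mulrzA -pmulrn; exact: is_subgroupMz.
  have [[u v]] := coprimezP _ _ qk; rewrite /= => uv.
  have [j jN xj] := mulrz_mod_exponent x v; exists j => //.
  have -> : y - x *+ j = (y *+ q) *~ u - (x - y *~ k) *~ v.
    rewrite -xj mulrzBl -[y *~ k *~ v]mulrzA pmulrn -mulrzA opprB addrA.
    by rewrite -mulrzDr mulrC addrC [k * v]mulrC -{1}(mulr1z y) -uv addrC mulrC.
  by apply: is_subgroupB => //; exact: is_subgroupMz.
have : forall n, M (s n *+ N) by move=> n; rewrite xN; exact: is_subgroup0.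
(* Induction over the prime factors of [N], for sequences killed by [d] modulo [M]. *)
move: s; apply: (@prime_mul_ind (fun d => forall s : nat -> G,
  (forall n, M (s n *+ d)) -> exists c, F [set n | M (s n - c)]) _ _ N N_gt0).
  move=> s sn; exists 0; apply: filterS filterT => n _ /=.
  by rewrite subr0 -[s n]mulr1n.
move=> q d qP d0 IHd s sn.
have [|c Fc] := IHd (fun n => s n *+ q); first by move=> n; rewrite -mulrnA.
(* Relative to the fixed term [s n0], F-almost all terms are killed by [q] modulo [M], hence
   congruent to one of [N] multiples of [x]; the ultrafilter selects one. *)
have [n0 /= sn0] := filter_ex Fc.
have [|j jN Fj] := @ultra_pigeonhole nat F N
    (fun j n => M (s n - s n0 - x *+ j)) UF; last first.
  by exists (s n0 + x *+ j); apply: filterS Fj => n /=; rewrite opprD addrA.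
apply: filterS Fc => n /= snc; apply: (primeM q) => //.
have -> : (s n - s n0) *+ q = (s n *+ q - c) - (s n0 *+ q - c).
  by rewrite opprB addrA subrK mulrnBl.
exact: is_subgroupB.
Qed.

End UltraSeparation.

(** * Local minimality and bases of open subgroups *)

Section BoundedLocallyMinimal.
Variables (X : topologicalZmodType) (N : nat).
Hypotheses (N_gt0 : (0 < N)%N) (xN : forall x : X, x *+ N = 0).

Definition open_subgroup (A : set X) := is_subgroup A /\ nbhs (0 : X) A.

Lemma open_subgroupI A B :
  open_subgroup A -> open_subgroup B -> open_subgroup (A `&` B).
Proof.
by move=> [sA nA] [sB nB]; split; [exact: is_subgroupI|exact: filterI].
Qed.

Lemma locally_GTG_open_subgroup : locally_GTG X ->
  forall W, nbhs (0 : X) W -> exists2 A, open_subgroup A & A `<=` W.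
Proof.
move=> [_ [B [Bn sB] BG]] W /sB[U BU UW]; exists (frac N U).
  split; first exact: (GTG_bounded_is_subgroup N_gt0 xN (BG U BU)).
  exact: (nbhs0_frac N (Bn U BU)).
by move=> x /(frac_subset N_gt0) /UW.
Qed.

Hypothesis hX : hausdorff_space X.
Hypothesis linX :
  forall W, nbhs (0 : X) W -> exists2 A, open_subgroup A & A `<=` W.

(** Such a family [B] is a basis of a coarser Hausdorff group topology in which [V] is a
    neighborhood of 0, because [K] lies in [V]; minimality identifies it with the given topology. *)
Lemma locally_minimal_open_subgroup : locally_minimal X ->
  exists2 K, open_subgroup K &
    forall B : set (set X), B !=set0 ->
      (forall U V, B U -> B V -> exists2 W, B W & W `<=` U `&` V) ->
      (forall U, B U -> open_subgroup U /\ U `<=` K) ->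
      (forall x, (forall U, B U -> U x) -> x = 0) ->
      forall W, nbhs (0 : X) W -> exists2 U, B U & U `<=` W.
Proof.
move=> [_ [V nV Vmin]]; have [K oK KV] := linX nV.
exists K => // B B0 BI BK Bsep W nW.
have [||||sigma bsigma] := @group_topology_of_base X B.
- exact: B0.
- exact: BI.
- by move=> U /BK[[/is_subgroup0]].
- by move=> U BU; exists U => // x y; apply: is_subgroupB; have [[]] := BK U BU.
have [sn sb] := bsigma; have Bn U : B U -> nbhs (0 : X) U by move=> /BK[[]].
have so := topen_sub_open bsigma Bn.
have sE : topen sigma = (open : set (set X)).
  apply: Vmin => //.
    apply/hausdorff_nbhs0 => x xU; apply: Bsep => U BU.
    by apply: xU; exact: sn.
  have [U BU] := B0.
  apply: (@filterS (tgroup sigma) _ (nbhs_filter (0 : tgroup sigma)) U V)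
    (sn U BU).
  by have [_ UK] := BK U BU; exact: subset_trans KV.
apply: sb; move: nW; rewrite !nbhsE => -[P [oP P0] PW].
exists P => //; split=> //.
by move: oP; rewrite -sE.
Qed.

End BoundedLocallyMinimal.

Section MinimalOpenSubgroup.
Variables (X : topologicalZmodType) (N : nat).
Hypotheses (N_gt0 : (0 < N)%N) (xN : forall x : X, x *+ N = 0).
Hypothesis hX : hausdorff_space X.
Hypothesis linX :
  forall W, nbhs (0 : X) W -> exists2 A, open_subgroup A & A `<=` W.
Variable K : set X.
Hypothesis oK : open_subgroup K.
Hypothesis minK : forall B : set (set X), B !=set0 ->
  (forall U V, B U -> B V -> exists2 W, B W & W `<=` U `&` V) ->
  (forall U, B U -> open_subgroup U /\ U `<=` K) ->
  (forall x, (forall U, B U -> U x) -> x = 0) ->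
  forall W, nbhs (0 : X) W -> exists2 U, B U & U `<=` W.
Variable F : set_system nat.
Context {UF : UltraFilter F}.

Let PF : ProperFilter F. Proof. exact: ultra_proper. Qed.

Let ultra_bounded (W : set X) := forall s : nat -> X, (forall n, K (s n)) ->
  exists c, F [set n | W (s n - c)].

(** The two limits modulo [U] and [V] can be replaced by one common term [s m] of the sequence. *)
Let ultra_boundedI (U V : set X) : is_subgroup U -> is_subgroup V ->
  ultra_bounded U -> ultra_bounded V -> ultra_bounded (U `&` V).
Proof.
move=> sU sV bU bV s sK; have [c Uc] := bU s sK; have [d Vd] := bV s sK.
have [m /= [Um Vm]] := filter_ex (filterI Uc Vd); exists (s m).
apply: filterS (filterI Uc Vd) => n [/= Un Vn].
have subE e : s n - s m = (s n - e) - (s m - e) by rewrite opprB addrA subrK.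
by split; [rewrite (subE c)|rewrite (subE d)]; exact: is_subgroupB.
Qed.

Lemma open_subgroup_separates x : x <> 0 ->
  exists W, [/\ open_subgroup W, W `<=` K & ~ W x].
Proof.
move=> x0; apply: contrapT => nW; apply: x0.
apply: (hausdorff_nbhs0 X).1 => // A nA.
have [W oW WA] := linX nA; apply: contrapT => Ax.
apply: nW; exists (W `&` K); split; [exact: open_subgroupI|by move=> y []|].
by move=> [/WA].
Qed.

(** The ultra-bounded open subgroups inside [K] satisfy the conditions of [minK]: [ultra_separation]
    shows that they separate points. The property then passes to larger subgroups. *)
Lemma open_subgroup_ultra_bounded W : open_subgroup W -> ultra_bounded W.
Proof.
move=> [_ nW].
have [||||U [_ _ bU] UW] := minK (B := [set U | [/\ open_subgroup U, U `<=` K &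
    ultra_bounded U]]) _ _ _ _ nW.
- exists K; split=> // s sK; exists 0; apply: filterS filterT => n _ /=.
  by rewrite subr0.
- move=> U V [oU UK bU] [oV VK bV]; exists (U `&` V) => //; split.
  + exact: open_subgroupI.
  + by move=> x [/UK].
  + by apply: ultra_boundedI => //; [case: oU|case: oV].
- by move=> U [].
- move=> x xU; apply: contrapT => /open_subgroup_separates[V [[sV nV] VK Vx]].
  have [M [sM VM Mx bM]] := ultra_separation N_gt0 xN sV Vx.
  apply: Mx; apply: (xU (M `&` K) _).1; split=> //.
    by apply: open_subgroupI => //; split=> //; exact: filterS nV.
  apply: ultra_boundedI => //; first by case: oK.
  move=> s sK; exists 0; apply: filterS filterT => n _ /=.
  by rewrite subr0.
- by move=> s /bU[c Uc]; exists c; apply: filterS Uc => n /= /UW.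
Qed.

(** If each [i < p] failed at some open subgroup, the intersection of these finitely many subgroups
    would defeat all [i] at once. *)
Let directed_pigeonhole (p : nat) (E : nat -> set X -> Prop) :
  (forall i U V, U `<=` V -> E i U -> E i V) ->
  (forall W, open_subgroup W -> W `<=` K -> exists2 i, (i < p)%N & E i W) ->
  exists2 i, (i < p)%N & forall W, open_subgroup W -> W `<=` K -> E i W.
Proof.
move=> Emono EW; apply: contrapT => nE.
have [W [oW WK nW]] : exists W, [/\ open_subgroup W, W `<=` K &
    forall i, (i < p)%N -> ~ E i W].
  have : (p <= p)%N by []. move: {1 3}p => q.
  elim: q => [|q IHq] qp; first by exists K; split.
  have [W [oW WK nW]] := IHq (ltnW qp).
  have [V [oV VK nV]] : exists V, [/\ open_subgroup V, V `<=` K & ~ E q V].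
    apply: contrapT => nV; apply: nE; exists q => // V oV VK.
    by apply: contrapT => EV; apply: nV; exists V.
  exists (W `&` V); split; [exact: open_subgroupI|by move=> x [/WK]|].
  move=> i; rewrite ltnS leq_eqVlt => /orP[/eqP->|iq] EWV.
    by apply: nV; apply: Emono EWV; exact: subIsetr.
  by apply: (nW i iq); apply: Emono EWV; exact: subIsetl.
by have [i ip] := EW W oW WK; exact: nW.
Qed.

(* If s had no F-limit t, the subgroups V + <s> (taken at the limit along F)
   would define a strictly coarser Hausdorff topology. *)
Lemma ultra_limit (p : nat) (s : nat -> X) : prime p -> (forall n, K (s n)) ->
  (forall n, s n *+ p = 0) ->
  exists t, forall W, open_subgroup W -> F [set n | W (s n - t)].
Proof.
move=> pP sK sp; apply: contrapT => nlim.
have limP t : ~ forall W, open_subgroup W -> W `<=` K ->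
    F [set n | W (s n - t)].
  move=> tW; apply: nlim; exists t => W oW.
  have : F [set n | (W `&` K) (s n - t)].
    by apply: tW; [exact: open_subgroupI|move=> x []].
  by apply: filterS => n [].
pose thick (V : set X) :=
  [set k | exists i : nat, F [set n | V (k - s n *+ i)]].
have thickS U V : U `<=` V -> thick U `<=` thick V.
  by move=> UV k [i Ui]; exists i; apply: filterS Ui => n /= /UV.
have thickK V : V `<=` K -> thick V `<=` K.
  move=> VK k [i /filter_ex[n /= /VK Kn]].
  rewrite -(subrK (s n *+ i) k); have [sKK _] := oK.
  by apply: is_subgroupD => //; exact: is_subgroupMn.
have thick_sub V : V `<=` thick V.
  by move=> k Vk; exists 0%N; apply: filterS filterT => n _ /=; rewrite subr0.
have thick_open V : open_subgroup V -> open_subgroup (thick V).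
  move=> [sV nV]; split; last exact: filterS nV.
  split; first by apply: thick_sub; exact: is_subgroup0.
  (* As [p] kills the sequence, the multiplier j(p - 1) acts as -j while remaining a natural
     number. *)
  move=> k l [i ki] [j lj]; exists (i + j * p.-1)%N.
  apply: filterS (filterI ki lj) => n [/= kin ljn].
  have -> : k - l - s n *+ (i + j * p.-1) = (k - s n *+ i) - (l - s n *+ j).
    have pj : s n *+ (j * p.-1) = - (s n *+ j).
      apply/eqP; rewrite -addr_eq0 -mulrnDr -mulnSr prednK ?prime_gt0//.
      by rewrite mulnC mulrnA sp mul0rn.
    by rewrite mulrnDr pj !opprD !opprK addrACA.
  exact: is_subgroupB.
have s0 W : open_subgroup W -> F [set n | W (s n - 0)].
  move=> [_ nW].
  have [||||_ [V [oV VK] <-] VW] := minK (B := [set thick V | V in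
      [set V | open_subgroup V /\ V `<=` K]]) _ _ _ _ nW.
  - by exists (thick K), K => //; split.
  - move=> _ _ [U [oU UK] <-] [V [oV VK] <-]; exists (thick (U `&` V)).
      by exists (U `&` V) => //; split; [exact: open_subgroupI|move=> x [/UK]].
    by rewrite subsetI; split; apply: thickS => x [].
  - by move=> _ [V [oV VK] <-]; split; [exact: thick_open|exact: thickK].
  - move=> k kV.
    (* One multiplier [i < p] serves all open subgroups inside [K]. If [i] is 0, [k] lies in all of
       them; otherwise inverting [i] modulo [p] makes a multiple of [k] an F-limit of [s]. *)
    have [|W' oW' W'K|i ip ki] := @directed_pigeonhole p
        (fun i V => F [set n | V (k - s n *+ i)]).
    + by move=> i U V UV; apply: filterS => n /= /UV.
    + have [i Fi] : thick W' k by apply: kV; exists W'.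
      exists (i %% p)%N; first by rewrite ltn_mod prime_gt0.
      apply: filterS Fi => n /=; rewrite {1}(divn_eq i p) mulrnDr mulnC mulrnA.
      by rewrite sp mul0rn add0r.
    + apply: contrapT => /[dup] k0 /open_subgroup_separates[V [oV VK Vk]].
      have [i0|i0] := posnP i.
        have [n /=] := filter_ex (ki V oV VK).
        by rewrite i0 subr0.
      have ipc : coprime i p.
        rewrite coprime_sym prime_coprime//; apply/negP => /(dvdn_leq i0).
        by rewrite leqNgt ip.
      have [j /eqP ij] := coprimeP p i0 ipc.
      have {}ij : (j.1 * i = 1 + j.2 * p)%N by lia.
      apply: (@limP (k *+ j.1)) => U oU UK.
      apply: filterS (ki U oU UK) => n /= Un.
      have -> : s n - k *+ j.1 = - ((k - s n *+ i) *+ j.1).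
        rewrite mulrnBl opprB -mulrnA mulnC ij mulrnDr mulr1n mulnC mulrnA sp.
        by rewrite mul0rn addr0.
      by have [sU _] := oU; apply: is_subgroupN => //; exact: is_subgroupMn.
  (* Since [s] is F-almost constant modulo [V], F-almost every term lies in [thick V] with
     multiplier 1, hence in [W]. *)
  - have [c Vc] := open_subgroup_ultra_bounded oV sK.
    apply: filterS (Vc) => m /= Vm; rewrite subr0; apply: VW; exists 1%N.
    apply: filterS Vc => n /= Vn; rewrite mulr1n.
    have -> : s m - s n = (s m - c) - (s n - c) by rewrite opprB addrA subrK.
    by have [sV _] := oV; exact: is_subgroupB.
by apply: (limP 0) => W oW _; exact: s0.
Qed.

End MinimalOpenSubgroup.

Section BoundedTorsion.
Variables (X : topologicalZmodType) (N : nat).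
Hypotheses (N_gt0 : (0 < N)%N) (xN : forall x : X, x *+ N = 0).

(** Otherwise each prime factor of [N] is excluded by some open subgroup, and intersecting these
    leaves only 0. *)
Lemma nondiscrete_prime_torsion : ~ discrete_group X ->
  exists2 p, prime p & forall W, open_subgroup (X := X) W ->
    exists a, [/\ W a, a != 0 & a *+ p = 0].
Proof.
move=> ndisc; apply: contrapT => noprime; apply: ndisc; apply: discrete_nbhs0.
have [W [_ nW] W0] : exists2 W, open_subgroup (X := X) W &
    forall x, W x -> x *+ N = 0 -> x = 0.
  apply: (@prime_mul_ind (fun d => exists2 W, open_subgroup (X := X) W &
    forall x, W x -> x *+ d = 0 -> x = 0) _ _ N N_gt0).
    exists setT; last by move=> x _; rewrite mulr1n.
    by split; [|exact: filterT].
  move=> q d qP d0 [W oW Wd].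
  have [V oV Vq] : exists2 V, open_subgroup (X := X) V &
      forall x, V x -> x *+ q = 0 -> x = 0.
    apply: contrapT => noV; apply: noprime; exists q => // V oV.
    apply: contrapT => Va; apply: noV; exists V => // x Vx xq.
    by apply: contrapT => /eqP x0; apply: Va; exists x.
  exists (W `&` V); first exact: open_subgroupI.
  move=> x [Wx Vx]; rewrite mulnC mulrnA => xdq; apply: Wd => //.
  by apply: Vq => //; have [sV _] := oV; exact: is_subgroupMn.
by apply: filterS nW => x Wx; apply: W0.
Qed.

Hypothesis hX : hausdorff_space X.
Hypothesis ndisc : ~ discrete_group X.

(* The F-limits of the partial sums of a n *+ e n, for e : nat -> bool, are
   pairwise distinct since a n lies in W n but not in W n.+1. *)
Lemma locally_minimal_continuum : locally_minimal X -> locally_GTG X ->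
  [set: nat -> bool] #<= [set: X].
Proof.
move=> lmX GTGX; have linX := locally_GTG_open_subgroup N_gt0 xN GTGX.
have [K oK minK] := locally_minimal_open_subgroup linX lmX.
have [p pP pa] := nondiscrete_prime_torsion ndisc.
have [F [UF oF]] := ultraFilterLemma eventually_filter.
have PF : ProperFilter F by exact: ultra_proper.
(* One step of the decreasing sequence; [(0, set0)] is a default value for sets that are not open
   subgroups. *)
have /choice[f fP] : forall W, exists aV : X * set X,
    open_subgroup W -> W `<=` K -> [/\ W aV.1, aV.1 *+ p = 0,
      open_subgroup aV.2, aV.2 `<=` W & ~ aV.2 aV.1].
  move=> W; have [oW|] := pselect (open_subgroup W); last by exists (0, set0).
  have [a [Wa /eqP a0 ap]] := pa W oW.
  have [V [oV VK Va]] := open_subgroup_separates hX linX oK a0.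
  exists (a, V `&` W) => _ _; split=> //=; first exact: open_subgroupI.
  by move=> [/Va].
pose W n := iter n (fun W => (f W).2) K; pose a n := (f (W n)).1.
have oW n : open_subgroup (W n) /\ W n `<=` K.
  elim: n => [|n [oWn WnK]]; first by split; [exact: oK|].
  have [_ _ oV VW _] := fP _ oWn WnK.
  by split=> //; exact: subset_trans WnK.
have aP n := fP _ (oW n).1 (oW n).2.
have sW n : is_subgroup (W n) by have [[]] := oW n.
have W_le m n : (m <= n)%N -> W n `<=` W m.
  move=> /subnK <-; elim: (n - m)%N => // d IHd.
  by have [_ _ _ VW _] := aP (d + m)%N; exact: subset_trans IHd.
pose s (e : nat -> bool) n : X := \sum_(i < n) a i *+ e i.
have sK e n : K (s e n).
  apply: big_rec => [|i x _ Kx]; first exact: (is_subgroup0 (sW 0%N)).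
  apply: (is_subgroupD (sW 0%N)) => //; apply: (is_subgroupMn (sW 0%N)).
  by have [Wa _ _ _ _] := aP i; exact: (W_le 0%N i).
have sp e n : s e n *+ p = 0.
  rewrite /s -sumrMnl big1// => i _; have [_ ap _ _ _] := aP i.
  by rewrite mulrnAC ap mul0rn.
have sS e m n : (m <= n)%N -> W m (s e n - s e m).
  move=> /subnK <-; elim: (n - m)%N => [|d IHd].
    by rewrite subrr; exact: is_subgroup0.
  rewrite addSn /s big_ord_recr /= addrAC; apply: is_subgroupD => //.
  apply: is_subgroupMn => //; have [Wa _ _ _ _] := aP (d + m)%N.
  by apply: W_le Wa; exact: leq_addl.
have /choice[t tP] : forall e, exists t, forall V, open_subgroup V ->
    F [set n | V (s e n - t)].
  by move=> e; exact: (ultra_limit N_gt0 xN hX linX oK minK pP (sK e) (sp e)).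
(* Modulo [W k.+1] each limit agrees with its partial sum of length [k.+1]. Once the earlier terms
   cancel, a disagreement at [k] would put [a k] in [W k.+1]. *)
have tI e e' : t e = t e' -> e = e'.
  move=> tE; apply/funext => k; elim/ltn_ind: k => k IHk.
  have Wk := (oW k.+1).1.
  have [n /= [[sn sn'] kn]] := filter_ex
    (filterI (filterI (tP e _ Wk) (tP e' _ Wk)) (oF _ (nbhs_infty_gt k))).
  have Wee : W k.+1 (s e k.+1 - s e' k.+1).
    have subE (e1 : nat -> bool) :
        s e1 k.+1 - t e1 = (s e1 n - t e1) - (s e1 n - s e1 k.+1).
      by rewrite opprB [RHS]addrC addrA subrK.
    have -> : s e k.+1 - s e' k.+1 = (s e k.+1 - t e) - (s e' k.+1 - t e').
      by rewrite tE opprB addrA subrK.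
    rewrite !subE.
    by apply: is_subgroupB => //; apply: is_subgroupB => //; exact: sS.
  have {Wee} : W k.+1 (a k *+ e k - a k *+ e' k).
    move: Wee; rewrite /s !big_ord_recr /=.
    have -> : \sum_(i < k) a i *+ e i = \sum_(i < k) a i *+ e' i.
      by apply: eq_bigr => i _; rewrite IHk.
    by rewrite opprD addrACA subrr add0r.
  have [_ _ _ _ Wa] := aP k.
  case: (e k) (e' k) => -[]; rewrite ?subr0 ?sub0r ?mulr1n//.
  by move/(is_subgroupN (sW _)); rewrite opprK.
have : range t #= [set: nat -> bool].
  by apply: inj_card_eq => e e' _ _; exact: tI.
rewrite card_eq_sym card_eq_le => /andP[le_t _].
exact: card_le_trans le_t (card_leT _).
Qed.

End BoundedTorsion.

Lemma bounded_no_small_topology (G : zmodType) (tau : group_topology G)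
    (N : nat) :
  (0 < N)%N -> (forall x : G, x *+ N = 0) -> lt_continuum [set: G] ->
  ~ discrete_group (tgroup tau) -> locally_minimal (tgroup tau) ->
  ~ locally_GTG (tgroup tau).
Proof.
move=> N0 xN [le_cont ne_cont] ndisc lm lG; apply: ne_cont.
rewrite card_eq_le le_cont /=.
have [hX _] := lm.
exact: (@locally_minimal_continuum (tgroup tau) N N0 xN hX ndisc lm lG).
Qed.

Unset Implicit Arguments.

Theorem theorem5p8 (R : realType) (G : zmodType) :
  [<-> (forall S : zmodClosed G, lt_continuum [set: subgroup S] ->
          ~ exists tau : group_topology (subgroup S),
              [/\ ~ discrete_group (tgroup tau),
                  locally_minimal (tgroup tau) &
                  locally_GTG (tgroup tau)]);
       (forall S : zmodClosed G, countable [set: subgroup S] ->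
          ~ exists tau : group_topology (subgroup S),
              [/\ ~ discrete_group (tgroup tau),
                  locally_quasi_convex R (tgroup tau) &
                  UFSS (tgroup tau)]);
       bounded_group G].
Proof.
tfae.
- move=> noGTG S cS [tau [ndisc _ ufss]]; apply: (noGTG S).
    exact: countable_lt_continuum.
  exists tau; split=> //; first exact: UFSS_locally_minimal.
  exact: UFSS_locally_GTG.
- move=> noUFSS; apply: contrapT => /(unbounded_small_subgroup R)[S [cS tau]].
  exact: (noUFSS S cS).
- move=> [N N0 xN] S cS [tau [ndisc lm lG]].
  apply: (bounded_no_small_topology N0 _ cS ndisc lm lG) => x.
  by apply: val_inj; rewrite raddfMn xN raddf0.
Qed.
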